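(* Let $r\ge 3$, let $\mathcal{B}=\{b_1,\dots,b_r\}$ be a set of $r$ distinct nonnegative integers, let $3\le L\le r$, and let $M\subseteq[n]$ be an $R_L$-sum-free set with $R=\mathcal{B}$. Let $\mathcal{H}_M$ be the hypergraph with vertex parts $V_1,\dots,V_r$ (pairwise disjoint copies of the integers, i.e. $V_j=\{j\}\times\mathbb{Z}$) whose edges are $A(y,m)=\{(1,y+b_1m),(2,y+b_2m),\dots,(r,y+b_rm)\}$ for $y\in[n]$, $m\in M$. Then $\mathcal{H}_M$ is an $r$-uniform $r$-partite linear hypergraph containing no rainbow cycles of length less than $L+1$.
   Context: $[n]=\{1,\dots,n\}$. Let $R=\{b_1,\dots,b_r\}$ be a set of $r$ distinct nonnegative integers and $3\le L\le r$. A set $M$ is $R_L$-sum-free if for every integer $l$ with $3\le l\le L$ and every choice of $l$ distinct elements $b_{j_1},\dots,b_{j_l}$ of $R$, the equation $(b_{j_2}-b_{j_1})m_1+\cdots+(b_{j_l}-b_{j_{l-1}})m_{l-1}+(b_{j_1}-b_{j_l})m_l=0$ has no solution with $m_i\in M$ except $m_1=\cdots=m_l$. A hypergraph is linear if any two distinct edges share at most one vertex; it is $r$-partite ($r$-uniform) if every edge contains exactly one vertex of each part $V_1,\dots,V_r$. A cycle of length $k$ ($k\ge 3$) is a sequence $v_1,A_1,\dots,v_k,A_k,v_1$ of distinct vertices and distinct edges with $v_i,v_{i+1}\in A_i$ ($1\le i\le k-1$) and $v_k,v_1\in A_k$; it is rainbow if $v_1,\dots,v_k$ lie in pairwise different parts.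 *)

(* Defs.v *)
From mathcomp Require Import all_boot all_order all_algebra finmap.

Set Implicit Arguments.
Unset Strict Implicit.
Unset Printing Implicit Defensive.

Local Open Scope fset_scope.
Local Open Scope ring_scope.

(* [ordS] is the cyclic successor on ['I_l], so the last summand carries the
   coefficient c_1 - c_l; the coefficients are computed in [int]. *)
Definition sum_free (R : {fset nat}) (L : nat) (M : {fset nat}) : Prop :=
  forall l : nat, (3 <= l <= L)%N ->
  forall c : 'I_l -> nat, injective c -> (forall i, c i \in R) ->
  forall m : 'I_l -> nat, (forall i, m i \in M) ->
    \sum_(i < l) ((c (ordS i))%:Z - (c i)%:Z) * (m i)%:Z = 0 ->
    forall i i', m i = m i'.

(* A hypergraph is given by its vertex type [V] and its set [E] of edges. *)
Section Hypergraphs.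
Variable V : choiceType.
Implicit Types (E : {fset {fset V}}) (r k : nat).

Definition uniform r E : Prop := forall A, A \in E -> #|` A| = r.

Definition linear_hypergraph E : Prop :=
  forall A B, A \in E -> B \in E -> A != B -> (#|` A `&` B| <= 1)%N.

Definition partite r (P : 'I_r -> {pred V}) E : Prop :=
  (forall v, exists! j, v \in P j) /\
  (forall A, A \in E -> forall j, exists! v, v \in A /\ v \in P j).

Definition is_cycle E k (v : 'I_k -> V) (A : 'I_k -> {fset V}) : Prop :=
  [/\ (3 <= k)%N, injective v, injective A, forall i, A i \in E
    & forall i, v i \in A i /\ v (ordS i) \in A i].

Definition rainbow r (P : 'I_r -> {pred V}) k (v : 'I_k -> V) : Prop :=
  exists2 p : 'I_k -> 'I_r, injective p & forall i, v i \in P (p i).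

End Hypergraphs.

Definition vertex_part r (j : 'I_r) : {pred 'I_r * int} :=
  [pred v : 'I_r * int | v.1 == j].

Definition HM_edge r (b : 'I_r -> nat) (y m : nat) : {fset 'I_r * int} :=
  [fset ((j, y%:Z + (b j)%:Z * m%:Z) : 'I_r * int) | j in 'I_r].

Definition HM_edges r (b : 'I_r -> nat) (n : nat) (M : {fset nat}) :
    {fset {fset 'I_r * int}} :=
  [fset HM_edge b y m | y in iota 1 n, m in M].

(* Main.v *)
(* Summing the increments of the integer coordinates along a rainbow cycle
   gives exactly the equation forbidden by sum-freeness, so all edges of the
   cycle have the same slope m; two consecutive edges then share a vertex and
   the slope, hence coincide. *)
Require Import Defs.
From mathcomp Require Import all_boot all_order all_algebra finmap.
From mathcomp Require Import ring.

Local Open Scope fset_scope.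

Import GRing.Theory.

Lemma in_HM_edge r (b : 'I_r -> nat) y m (v : 'I_r * int) :
  (v \in HM_edge b y m) = (v.2 == y%:Z + (b v.1)%:Z * m%:Z)%R.
Proof.
apply/imfsetP/eqP => [[j _ ->] //|v2E].
by exists v.1 => //; rewrite [LHS]surjective_pairing v2E.
Qed.

Lemma HM_edgesP r (b : 'I_r -> nat) n (M : {fset nat}) A :
  A \in HM_edges b n M -> exists2 ym, ym.2 \in M & A = HM_edge b ym.1 ym.2.
Proof. by case/imfset2P => y _ [m mM ->]; exists (y, m). Qed.

Lemma card_HM_edge r (b : 'I_r -> nat) y m : #|` HM_edge b y m| = r.
Proof. by rewrite card_imfset => [|i j []//]; rewrite /= -cardE card_ord. Qed.

(** With [m] fixed, a vertex [v] of the edge determines the offset: [y] equals [v.2] minus [b v.1]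
    times [m]. *)
Lemma HM_edge_same_slope r (b : 'I_r -> nat) y y' m (v : 'I_r * int) :
  v \in HM_edge b y m -> v \in HM_edge b y' m ->
  HM_edge b y m = HM_edge b y' m.
Proof. by rewrite !in_HM_edge => /eqP-> /eqP/addIr[->]. Qed.

(** Subtracting the equations of two common vertices eliminates both offsets and leaves a multiple
    of the difference of the slopes; injectivity of [b] makes the factor nonzero. *)
Lemma HM_edge_meet2 r (b : 'I_r -> nat) y y' m m' (u v : 'I_r * int) :
  injective b -> u != v ->
  u \in HM_edge b y m -> v \in HM_edge b y m ->
  u \in HM_edge b y' m' -> v \in HM_edge b y' m' ->
  HM_edge b y m = HM_edge b y' m'.
Proof.
move=> b_inj; case: u v => [i x] [j z] uv uA vA uB vB.
suff mE : m = m' by rewrite -mE in uB *; apply: HM_edge_same_slope uA uB.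
move: uA vA uB vB uv; rewrite !in_HM_edge /= => /eqP -> /eqP -> /eqP iE /eqP jE.
(* An edge has only one vertex in each part, so [i = j] would contradict [u != v]. *)
have [<-|/eqP ij _] := eqVneq i j; first by rewrite eqxx.
have /eqP : (((b i)%:Z - (b j)%:Z) * (m%:Z - m'%:Z) = 0)%R.
  transitivity ((y%:Z + (b i)%:Z * m%:Z) - (y'%:Z + (b i)%:Z * m'%:Z)
    - ((y%:Z + (b j)%:Z * m%:Z) - (y'%:Z + (b j)%:Z * m'%:Z)))%R; first by ring.
  by rewrite iE jE !subrr.
by rewrite mulf_eq0 !subr_eq0 => /orP[] /eqP[] // /b_inj.
Qed.

Lemma HM_edges_partite r (b : 'I_r -> nat) n (M : {fset nat}) :
  partite (@vertex_part r) (HM_edges b n M).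
Proof.
split=> [v|_ /HM_edgesP[[y m] _ ->] j].
  by exists v.1; split=> [|j]; rewrite inE // => /eqP.
exists (j, y%:Z + (b j)%:Z * m%:Z)%R; split=> [|[i x]].
  by rewrite in_HM_edge inE /= !eqxx.
by rewrite in_HM_edge inE /= => -[/eqP-> /eqP->].
Qed.

Lemma HM_edges_linear r (b : 'I_r -> nat) n (M : {fset nat}) :
  injective b -> linear_hypergraph (HM_edges b n M).
Proof.
move=> b_inj _ _ /HM_edgesP[[y m] _ ->] /HM_edgesP[[y' m'] _ ->] /= AB.
rewrite leqNgt cardfE; apply: contraNN AB => /card_gt1P[u [v [_ _ uv]]].
have /fsetIP[uA uB] := valP u; have /fsetIP[vA vB] := valP v.
by apply/eqP; apply: HM_edge_meet2 b_inj _ uA vA uB vB.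
Qed.

(** [ordS] permutes the indices, so both halves of the difference have the same sum. *)
Lemma sum_ordS (V : zmodType) k (F : 'I_k -> V) :
  (\sum_(i < k) (F (ordS i) - F i) = 0)%R.
Proof.
rewrite sumrB [X in (X - _)%R](_ : _ = \sum_(i < k) F i)%R ?subrr //.
by rewrite [RHS](reindex _ (onW_bij _ (@ordS_bij k))).
Qed.

Lemma ordS_neq k (i : 'I_k) : (1 < k)%N -> ordS i != i.
Proof.
move=> k_gt1; rewrite -val_eqE /=; have := ltn_ord i.
rewrite leq_eqVlt => /predU1P[iE|ik].
  (* At the last index the successor wraps around to 0, and [i = 0] would give [k = 1]. *)
  by rewrite iE modnn; apply: contraTneq k_gt1 => i0; rewrite -iE -i0.
by rewrite modn_small // gtn_eqF.
Qed.

Lemma HM_edges_no_rainbow_cycle r n L (b : 'I_r -> nat) (M : {fset nat}) k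
    (v : 'I_k -> 'I_r * int) (A : 'I_k -> {fset 'I_r * int}) :
  injective b -> sum_free [fset b j | j in 'I_r] L M -> (k <= L)%N ->
  is_cycle (HM_edges b n M) v A -> ~ rainbow (@vertex_part r) v.
Proof.
move=> b_inj M_sum_free kL [k_ge3 _ A_inj AE vA] [p p_inj pE].
have {}pE i : (v i).1 = p i by apply/eqP/pE.
have /fin_all_exists2[ym ymM ymE] i := HM_edgesP _ _ _ _ _ (AE i).
have vE i : (v i).2 = ((ym i).1%:Z + (b (p i))%:Z * (ym i).2%:Z)%R.
  by have [+ _] := vA i; rewrite ymE in_HM_edge pE => /eqP.
have vSE i :
    (v (ordS i)).2 = ((ym i).1%:Z + (b (p (ordS i)))%:Z * (ym i).2%:Z)%R.
  by have [_ +] := vA i; rewrite ymE in_HM_edge pE => /eqP.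
have m_const : forall i j, (ym i).2 = (ym j).2.
  (* The cycle length serves as [l]; the coefficients [b \o p] are distinct because the cycle is
     rainbow and [b] is injective. *)
  apply: (M_sum_free k _ (b \o p)) => //; first by rewrite k_ge3.
  - exact: inj_comp.
  - by move=> i; apply: in_imfset.
  (* [v i] and [v (ordS i)] both lie on [A i], so its offset cancels in their difference, leaving
     the i-th summand. *)
  rewrite -[RHS](sum_ordS _ _ (fun i => (v i).2)); apply: eq_bigr => i _.
  by rewrite vSE vE /=; ring.
pose i0 := Ordinal (ltnW (ltnW k_ge3)).
have /eqP[] : ordS i0 != i0 by apply: ordS_neq; apply: ltnW.
apply: A_inj.
(* The vertex [v (ordS i0)] lies on both [A i0] and [A (ordS i0)], which have equal slopes. *)
have [_ v1A0] := vA i0; have [v1A1 _] := vA (ordS i0).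
move: v1A0 v1A1; rewrite !ymE (m_const (ordS i0) i0) => v1A0 v1A1.
exact: HM_edge_same_slope v1A1 v1A0.
Qed.

Theorem theorem11 (r n L : nat) (b : 'I_r -> nat) (M : {fset nat})
    (r_ge3 : (3 <= r)%N) (b_inj : injective b) (L_bounds : (3 <= L <= r)%N)
    (M_sub : forall m, m \in M -> (1 <= m <= n)%N)
    (M_sum_free : sum_free [fset b j | j in 'I_r] L M) :
  [/\ uniform r (HM_edges b n M),
      partite (@vertex_part r) (HM_edges b n M),
      linear_hypergraph (HM_edges b n M)
    & forall k, (k < L.+1)%N ->
      ~ exists (v : 'I_k -> 'I_r * int) (A : 'I_k -> {fset 'I_r * int}),
          is_cycle (HM_edges b n M) v A /\ rainbow (@vertex_part r) v].
Proof.
split.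
- by move=> _ /HM_edgesP[[y m] _ ->]; apply: card_HM_edge.
- exact: HM_edges_partite.
- exact: HM_edges_linear.
- move=> k kL [v [A [vA_cycle]]].
  exact: HM_edges_no_rainbow_cycle b_inj M_sum_free kL vA_cycle.
Qed.
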